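(* Let $p_l(z)=z^m+q_{m-1}z^{m-1}+\dots+q_1z+q_0$ be a simple monic polynomial over $\mathbb{H}$ of degree $m$ with $q_0\neq0$. Let $w_i$, $1\le i\le m$, be positive real numbers, let $W:=\mathrm{diag}(w_1,w_2,\dots,w_m)$ and let $\gamma\in[0,1]$. Then every zero $\tilde z\in\mathbb{H}$ of $p_l(z)$ satisfies $$\left[\max_{1\le i\le m}\left\{r_i'(WC_{q_l}W^{-1})^{\gamma}\,c_i'(WC_{q_l}W^{-1})^{1-\gamma}\right\}\right]^{-1}\le|\tilde z|\le\max_{1\le i\le m}\left\{r_i'(WC_{p_l}W^{-1})^{\gamma}\,c_i'(WC_{p_l}W^{-1})^{1-\gamma}\right\}.$$
   Context: $\mathbb{H}$ is the skew field of real quaternions with its usual modulus $|\cdot|$. The polynomial $p_l(z)=z^m+\sum_{j=0}^{m-1}q_jz^j$, $q_j\in\mathbb{H}$, has its coefficients on the left and is evaluated at $z\in\mathbb{H}$. For a monic polynomial $z^m+\sum_{j=0}^{m-1}b_jz^j$ with left coefficients, its companion matrix is the $m\times m$ matrix with ones in positions $(i,i+1)$, $1\le i\le m-1$, last row $(-b_0,-b_1,\dots,-b_{m-1})$, and zeros elsewhere. $C_{p_l}$ is the companion matrix of $p_l$. The reversal polynomial of $p_l$ is $q_l(z):=z^m+q_0^{-1}q_1z^{m-1}+\dots+q_0^{-1}q_{m-1}z+q_0^{-1}$, and $C_{q_l}$ is its companion matrix. For $A=(a_{ij})\in M_m(\mathbb{H})$, $r_i'(A):=\sum_{j=1}^m|a_{ij}|$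 and $c_i'(A):=\sum_{j=1}^m|a_{ji}|$. *)

(* Defs.v *)
From HB Require Import structures.
From mathcomp Require Import all_boot all_order all_algebra ring lra.
From mathcomp Require Import all_classical all_reals all_analysis.

Set Implicit Arguments.
Unset Strict Implicit.
Unset Printing Implicit Defensive.

Import Order.TTheory GRing.Theory Num.Theory.
Local Open Scope ring_scope.

(* [Quat a b c d] is a + b i + c j + d k. *)
Record quat (R : Type) := Quat { qre : R; qi : R; qj : R; qk : R }.

Definition quat_to_prod (R : Type) (x : quat R) : R * R * R * R :=
  (qre x, qi x, qj x, qk x).
Definition prod_to_quat (R : Type) (t : R * R * R * R) : quat R :=
  Quat t.1.1.1 t.1.1.2 t.1.2 t.2.

Lemma quat_to_prodK (R : Type) : cancel (@quat_to_prod R) (@prod_to_quat R).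
Proof. by case. Qed.

HB.instance Definition _ (R : choiceType) :=
  Choice.copy (quat R) (can_type (@quat_to_prodK R)).

Section QuatRing.
Variable R : realType.
Implicit Types x y z : quat R.

Definition qzero : quat R := Quat 0 0 0 0.
Definition qone : quat R := Quat 1 0 0 0.
Definition qopp x : quat R := Quat (- qre x) (- qi x) (- qj x) (- qk x).
Definition qadd x y : quat R :=
  Quat (qre x + qre y) (qi x + qi y) (qj x + qj y) (qk x + qk y).
Definition qmul x y : quat R :=
  Quat (qre x * qre y - qi x * qi y - qj x * qj y - qk x * qk y)
       (qre x * qi y + qi x * qre y + qj x * qk y - qk x * qj y)
       (qre x * qj y - qi x * qk y + qj x * qre y + qk x * qi y)
       (qre x * qk y + qi x * qj y - qj x * qi y + qk x * qre y).
Definition qsqnorm x : R := qre x ^+ 2 + qi x ^+ 2 + qj x ^+ 2 + qk x ^+ 2.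
Definition qinv x : quat R :=
  Quat (qre x / qsqnorm x) (- qi x / qsqnorm x)
       (- qj x / qsqnorm x) (- qk x / qsqnorm x).

Lemma quat_eq x y :
  qre x = qre y -> qi x = qi y -> qj x = qj y -> qk x = qk y -> x = y.
Proof. by case: x y => [? ? ? ?] [? ? ? ?] /= -> -> -> ->. Qed.

Lemma qaddA : associative qadd.
Proof. by move=> x y z; apply: quat_eq => /=; ring. Qed.
Lemma qaddC : commutative qadd.
Proof. by move=> x y; apply: quat_eq => /=; ring. Qed.
Lemma qadd0 : left_id qzero qadd.
Proof. by move=> x; apply: quat_eq => /=; ring. Qed.
Lemma qaddN : left_inverse qzero qopp qadd.
Proof. by move=> x; apply: quat_eq => /=; ring. Qed.

HB.instance Definition _ :=
  GRing.isZmodule.Build (quat R) qaddA qaddC qadd0 qaddN.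

Lemma qmulA : associative qmul.
Proof. by move=> x y z; apply: quat_eq => /=; ring. Qed.
Lemma qmul1l : left_id qone qmul.
Proof. by move=> x; apply: quat_eq => /=; ring. Qed.
Lemma qmul1r : right_id qone qmul.
Proof. by move=> x; apply: quat_eq => /=; ring. Qed.
Lemma qmulDl : left_distributive qmul +%R.
Proof. by move=> x y z; apply: quat_eq => /=; ring. Qed.
Lemma qmulDr : right_distributive qmul +%R.
Proof. by move=> x y z; apply: quat_eq => /=; ring. Qed.
Lemma qone_neq0 : qone != 0.
Proof. by apply/eqP => -[] /eqP; rewrite oner_eq0. Qed.

HB.instance Definition _ :=
  GRing.Zmodule_isNzRing.Build (quat R)
    qmulA qmul1l qmul1r qmulDl qmulDr qone_neq0.

Lemma qsqnorm_eq0 x : (qsqnorm x == 0) = (x == 0).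
Proof.
apply/eqP/eqP => [h|->]; last by rewrite /qsqnorm /= !expr0n /= !addr0.
have p (a : R) := sqr_ge0 a.
have := (p (qre x), p (qi x), p (qj x), p (qk x)).
move: h; rewrite /qsqnorm => h [[[h1 h2] h3] h4].
by apply: quat_eq => /=; apply/eqP; rewrite -sqrf_eq0; apply/eqP; lra.
Qed.

Lemma qmulVx : {in [pred x | x != 0], left_inverse 1 qinv *%R}.
Proof.
move=> x; rewrite inE -qsqnorm_eq0 => x0.
by apply: quat_eq => /=; move: x0; rewrite /qsqnorm => x0; field.
Qed.

Lemma qmulxV : {in [pred x | x != 0], right_inverse 1 qinv *%R}.
Proof.
move=> x; rewrite inE -qsqnorm_eq0 => x0.
by apply: quat_eq => /=; move: x0; rewrite /qsqnorm => x0; field.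
Qed.

Lemma qunitP x y : y * x = 1 /\ x * y = 1 -> x \in [pred x | x != 0].
Proof.
move=> [yx _]; rewrite inE; apply/eqP => x0.
by move/eqP: yx; rewrite x0 mulr0 eq_sym oner_eq0.
Qed.

Lemma qinv_out : {in [predC [pred x | x != 0]], qinv =1 id}.
Proof.
move=> x; rewrite !inE negbK => /eqP ->.
by apply: quat_eq; rewrite /= ?oppr0 mul0r.
Qed.

HB.instance Definition _ :=
  GRing.NzRing_hasMulInverse.Build (quat R) qmulVx qmulxV qunitP qinv_out.

Definition qmod x : R := Num.sqrt (qsqnorm x).
Definition qreal (a : R) : quat R := Quat a 0 0 0.

End QuatRing.

Section ZeroBounds.
Variable R : realType.

Definition rowsum n (A : 'M[quat R]_n) (i : 'I_n) : R :=
  \sum_(j < n) qmod (A i j).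
Definition colsum n (A : 'M[quat R]_n) (i : 'I_n) : R :=
  \sum_(j < n) qmod (A j i).

(* The weights are indexed by nat, only the first n being used, because the
   size of [companionmx p] is [(size p).-1] and so depends on p; it is the same
   for [p] and [reversal p], by [size_reversal] below. *)
Definition weightmx n (w : nat -> R) : 'M[R]_n := diag_mx (\row_(i < n) w i).
Definition weighted n (w : nat -> R) (A : 'M[quat R]_n) : 'M[quat R]_n :=
  map_mx (@qreal R) (weightmx n w) *m A
    *m map_mx (@qreal R) (invmx (weightmx n w)).

(* The terms are nonnegative, so the default value 0 is harmless when n > 0. *)
Definition max_rowcol n (gamma : R) (A : 'M[quat R]_n) : R :=
  \big[Num.max/0]_(i < n) (rowsum A i `^ gamma * colsum A i `^ (1 - gamma)).

(* [{poly _}] over a noncommutative ring has its coefficients on the left, and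
   [p.[z]] is the sum of the [p`_i * z ^+ i]. *)
Definition reversal (p : {poly quat R}) : {poly quat R} :=
  let m := (size p).-1 in
  'X^m + \sum_(1 <= j < m) ((p`_0)^-1 * p`_j) *: 'X^(m - j) + ((p`_0)^-1)%:P.

Lemma size_reversal (p : {poly quat R}) :
  (1 < size p)%N -> size (reversal p) = size p.
Proof.
move=> hp; set m := (size p).-1.
have hm : (0 < m)%N by rewrite /m -subn1 subn_gt0.
rewrite /reversal -/m -addrA size_polyDl size_polyXn.
  by rewrite prednK // ltnW.
rewrite ltnS (leq_trans (size_polyD _ _)) // geq_max.
apply/andP; split; last first.
  exact: leq_trans (size_polyC_leq1 _) hm.
rewrite big_nat; apply: (big_ind (fun q : {poly quat R} => (size q <= m)%N)).
- by rewrite size_poly0.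
- by move=> q r hq hr; rewrite (leq_trans (size_polyD _ _)) // geq_max hq.
move=> j /andP[j1 _]; apply: leq_trans (size_scale_leq _ _) _.
by rewrite size_polyXn ltn_subrL j1 hm.
Qed.

End ZeroBounds.

(* Main.v *)
Require Import Defs.
From HB Require Import structures.
From mathcomp Require Import all_boot all_order all_algebra ring.
From mathcomp Require Import all_classical all_reals all_analysis.

Import Order.TTheory GRing.Theory Num.Theory.
Local Open Scope ring_scope.

(** Why the theorem holds.  Let [C] be the companion matrix of a monic
    polynomial [p] and [v] the column of the powers [1, z, .., z ^+ (m - 1)].
    The rows of [C] above the last one shift [v], and the last row returns
    [z ^+ m] exactly when [p.[z] = 0].  Since the coefficients stand on the left
    and powers of [z] commute, this reads [C v = v z]: a zero of [p] is a right
    eigenvalue of [C] ([companionmx_mul_powers]), hence of [W C W^-1], with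
    eigenvector [W v] ([weighted_mul]).

    It remains to bound the modulus of a right eigenvalue by row and column
    sums (Ostrowski's theorem).  Taking moduli in [A u = u z] gives
    [|z| |u_i| <= \sum_j |a_ij| |u_j|], so everything reduces to a statement on
    nonnegative real matrices, [subinvariant_le_row_col].  For this the weighted
    AM-GM inequality replaces Hoelder's: with [t = gamma], [d = 1 - t] and
    [y_i = |u_i| ^ (1/d)], it bounds each [|a_ij| u'_i ^ t y_j ^ d] by
    [|a_ij| (t u'_i + d y_j)], where the [u'_i >= 0] are free.  A suitable choice
    of the [u'_i] turns the row sums into the quantities to be compared with the
    column sums, and summing over [i] concludes.

    This is the upper bound.  The lower bound is the upper bound for the
    reversal polynomial, which vanishes at [z^-1], because its value there is
    [q_0^-1 p(z) z^-m] ([horner_reversal]). *)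

(** * Row and column sums of nonnegative matrices *)

Lemma powR_weighted_amgm (R : realType) (a b t : R) :
  0 <= a -> 0 <= b -> 0 <= t <= 1 ->
  a `^ t * b `^ (1 - t) <= t * a + (1 - t) * b.
Proof.
move=> a0 b0 /andP[]; rewrite le_eqVlt => /predU1P[<- _|t0].
  by rewrite powRr0 subr0 powRr1 // !mul1r mul0r add0r.
rewrite le_eqVlt => /predU1P[->|t1].
  by rewrite subrr powRr0 powRr1 // mul0r mulr1 mul1r addr0.
have d0 : 0 < 1 - t by rewrite subr_gt0.
have := @conjugate_powR _ (a `^ t) (b `^ (1 - t)) t^-1 (1 - t)^-1
  (powR_ge0 _ _) (powR_ge0 _ _).
rewrite !invr_gt0 !invrK subrKC -!powRrM !divff ?gt_eqF // !powRr1 //.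
by rewrite mulrC [a * t]mulrC [b * (1 - t)]mulrC [b `^ _ * _]mulrC; apply.
Qed.

(** Ostrowski's bound, in the form of an inequality for a nonnegative matrix and
    a nonzero nonnegative vector.  Suppose that it fails at every [i].  With
    [d = 1 - t], [y_i = x_i ^ (1/d)] and [f_i = (l / r_i) ^ (1/d)], this means
    that the column sum [c_i] is smaller than [s_i = l f_i ^ t] wherever
    [x_i > 0].  On the other hand AM-GM applied to the pairs [f_i y_i], [y_j]
    gives [s_i y_i <= \sum_j b_ij y_j], and summing over [i] yields
    [\sum_i s_i y_i <= \sum_i c_i y_i], a contradiction.  The exponent [1/d]
    does not exist when [t = 1]; there only row sums occur, and an index where
    [x] is largest works. *)
Lemma subinvariant_le_row_col (R : realType) (n : nat)
    (b : 'I_n -> 'I_n -> R) (x : 'I_n -> R) (l t : R) :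
  (forall i j, 0 <= b i j) -> (forall i, 0 <= x i) -> (exists i, 0 < x i) ->
  (forall i, l * x i <= \sum_j b i j * x j) -> 0 <= t <= 1 ->
  exists i, l <= (\sum_j b i j) `^ t * (\sum_j b j i) `^ (1 - t).
Proof.
move=> b0 x0 [i0 xi0] hl /[dup] ht /andP[t0 t1].
have [l0|l0] := leP l 0.
  by exists i0; rewrite (le_trans l0) // mulr_ge0 ?powR_ge0.
pose r i := \sum_j b i j; pose c i := \sum_j b j i.
have r0 i : 0 <= r i by apply: sumr_ge0.
have c0 i : 0 <= c i by apply: sumr_ge0.
move: t1; rewrite le_eqVlt => /predU1P[t1|t1].
  have [k _ kmax] := @arg_maxP _ _ _ i0 xpredT x isT.
  have xk : 0 < x k by apply: lt_le_trans xi0 (kmax i0 isT).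
  exists k; rewrite t1 subrr powRr0 mulr1 powRr1; last exact: r0.
  rewrite -(ler_pM2r xk) mulr_suml; apply: le_trans (hl k) _.
  by apply: ler_sum => j _; apply: ler_wpM2l => //; apply: kmax.
pose d := 1 - t; have d0 : 0 < d by rewrite subr_gt0.
have td : t + d = 1 by rewrite /d subrKC.
apply: contrapT => /forallNP hn.
have {}hn i : r i `^ t * c i `^ d < l by rewrite ltNge; apply/negP/hn.
pose y i := x i `^ d^-1.
have yd i : y i `^ d = x i by rewrite -powRrM mulVf ?gt_eqF // powRr1.
have y0 i : 0 <= y i by apply: powR_ge0.
have yz i : x i <= 0 -> y i = 0.
  move=> xi; have xi0' : x i = 0 by apply: le_anti; rewrite xi x0.
  by rewrite /y xi0' powR0 // invr_eq0 gt_eqF.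
(* The quotient [l / r i] below is meaningful on the support of [x]: a zero row
   would force [l * x i <= 0]. *)
have rpos i : 0 < x i -> 0 < r i.
  move=> xi; rewrite lt_neqAle r0 andbT eq_sym; apply/negP => /eqP ri.
  have bi j : b i j = 0.
    by apply: (psumr_eq0P _ ri).
  have := hl i; rewrite big1; last by move=> j _; rewrite bi mul0r.
  by rewrite leNgt mulr_gt0.
(* [f] is chosen so that [r i * f i = s i]: AM-GM then produces the term
   [t * (s i * y i)], which is absorbed by the left-hand side. *)
pose f i := (l / r i) `^ d^-1; pose s i := l * f i `^ t.
have f0 i : 0 <= f i by apply: powR_ge0.
have lr0 i : 0 <= l / r i by rewrite divr_ge0 // ltW.
have fd i : f i `^ d = l / r i by rewrite -powRrM mulVf ?gt_eqF // powRr1.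
have split1 a : 0 <= a -> a `^ t * a `^ d = a.
  by move=> a0; rewrite -powRD ?td ?oner_eq0 // powRr1.
have sf i : 0 < x i -> r i * f i = s i.
  move=> xi; rewrite -{1}(split1 (f i)) // fd /s.
  by field; rewrite gt_eqF // rpos.
have cs i : 0 < x i -> c i < s i.
  move=> xi; rewrite ltNge; apply/negP => sc; have := hn i; apply/negP.
  rewrite -leNgt.
  have s0 : 0 <= s i by rewrite mulr_ge0 ?powR_ge0 // ltW.
  have -> : l = r i `^ t * s i `^ d.
    rewrite /s powRM ?powR_ge0 //; last exact: ltW.
    rewrite powRAC fd mulrCA -powRM // [r i * _]mulrC divfK ?gt_eqF ?rpos //.
    by rewrite mulrC split1 // ltW.
  by rewrite ler_wpM2l ?powR_ge0 // ge0_ler_powR ?nnegrE // ltW.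
have main i : s i * y i <= \sum_j b i j * y j.
  have [xi|xi] := leP (x i) 0.
    by rewrite yz // mulr0 sumr_ge0 // => j _; rewrite mulr_ge0.
  have u0 : 0 <= f i * y i by rewrite mulr_ge0.
  have h : s i * y i <= t * (s i * y i) + d * \sum_j b i j * y j.
    have -> : s i * y i = (f i * y i) `^ t * (l * x i).
      by rewrite /s powRM // -{1}(split1 (y i)) // yd; ring.
    apply: le_trans (ler_wpM2l (powR_ge0 _ _) (hl i)) _.
    rewrite [in leRHS](_ : _ * (l * x i) = r i * (f i * y i)); last first.
      by rewrite [RHS]mulrA sf // /s powRM // -{2}(split1 (y i)) // yd; ring.
    rewrite !mulr_suml !mulr_sumr -big_split /=; apply: ler_sum => j _.
    have := powR_weighted_amgm _ _ _ _ u0 (y0 j) ht.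
    rewrite -/d yd => /(ler_wpM2l (b0 i j)).
    by congr (_ <= _); ring.
  rewrite -(ler_pM2l d0); move: h; rewrite -{1}(mul1r (s i * y i)) -td mulrDl.
  by rewrite lerD2l.
have : \sum_i s i * y i <= \sum_i c i * y i.
  apply: le_trans (ler_sum _ (fun i _ => main i)) _.
  by rewrite exchange_big /=; apply: ler_sum => j _; rewrite mulr_suml.
(* Strictness comes from the index [i0], where [y i0] is positive. *)
apply/negP; rewrite -ltNge (bigD1 i0) // [ltRHS](bigD1 i0) //=.
apply: ltr_leD; first by rewrite ltr_pM2r ?cs // powR_gt0.
apply: ler_sum => i _; have [xi|xi] := ltP 0 (x i).
  by rewrite ler_wpM2r // ltW // cs.
by rewrite yz // !mulr0.
Qed.

(** * The quaternionic modulus *)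

Lemma qsqnorm_ge0 (R : realType) (x : quat R) : 0 <= qsqnorm x.
Proof. by rewrite /qsqnorm !addr_ge0 // sqr_ge0. Qed.

Lemma qmod_ge0 (R : realType) (x : quat R) : 0 <= qmod x.
Proof. exact: sqrtr_ge0. Qed.

Lemma qmod_gt0 (R : realType) (x : quat R) : (0 < qmod x) = (x != 0).
Proof. by rewrite sqrtr_gt0 lt0r qsqnorm_ge0 andbT qsqnorm_eq0. Qed.

(** Euler's four-square identity. *)
Lemma qmodM (R : realType) (x y : quat R) : qmod (x * y) = qmod x * qmod y.
Proof.
rewrite /qmod -sqrtrM ?qsqnorm_ge0 //; congr Num.sqrt.
by rewrite /qsqnorm /=; ring.
Qed.

Lemma qmod1 (R : realType) : qmod (1 : quat R) = 1.
Proof. by rewrite /qmod /qsqnorm /= expr1n !expr0n /= !addr0 sqrtr1. Qed.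

Lemma qmodV (R : realType) (x : quat R) : x != 0 -> qmod x^-1 = (qmod x)^-1.
Proof.
move=> x0; have mx0 : qmod x != 0 by rewrite gt_eqF // qmod_gt0.
by apply: (mulIf mx0); rewrite -qmodM mulVr // qmod1 mulVf.
Qed.

(** The Cauchy-Schwarz inequality for the scalar product of R^4, which is read
    off Lagrange's identity: the defect is the squared norm of the imaginary part
    of [x] times the conjugate of [y]. *)
Lemma qmodD (R : realType) (x y : quat R) : qmod (x + y) <= qmod x + qmod y.
Proof.
rewrite -ler_sqr ?nnegrE ?addr_ge0 ?qmod_ge0 // sqrrD !sqr_sqrtr ?qsqnorm_ge0 //.
pose ip := qre x * qre y + qi x * qi y + qj x * qj y + qk x * qk y.
have -> : qsqnorm (x + y) = qsqnorm x + ip *+ 2 + qsqnorm y.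
  by rewrite /qsqnorm /ip /=; ring.
rewrite lerD2r lerD2l lerMn2r /= (le_trans (ler_norm _)) //.
rewrite -sqrtr_sqr /qmod -sqrtrM ?qsqnorm_ge0 // ler_wsqrtr // -subr_ge0.
have -> : qsqnorm x * qsqnorm y - ip ^+ 2 =
    (qre x * qi y - qi x * qre y + qj x * qk y - qk x * qj y) ^+ 2 +
    (qre x * qj y - qj x * qre y + qk x * qi y - qi x * qk y) ^+ 2 +
    (qre x * qk y - qk x * qre y + qi x * qj y - qj x * qi y) ^+ 2.
  by rewrite /qsqnorm /ip; ring.
by rewrite !addr_ge0 // sqr_ge0.
Qed.

Lemma qmod_sum (R : realType) (n : nat) (F : 'I_n -> quat R) :
  qmod (\sum_i F i) <= \sum_i qmod (F i).
Proof.
elim/big_ind2: _ => // [|a x b y ha hb].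
  by rewrite /qmod /qsqnorm /= !expr0n /= !addr0 sqrtr0.
by apply: le_trans (qmodD _ _ _) _; apply: lerD.
Qed.

(** * Right eigenvalues and companion matrices *)

(** Taking moduli in each row of [A *m u = u z] makes the column of moduli of [u]
    subinvariant under the matrix of moduli of [A].  The scalar multiplies the
    entries of [u] on the right, which is not the scaling of matrices, hence the
    entrywise right-hand side. *)
Lemma right_eigen_le (R : realType) (n : nat) (A : 'M[quat R]_n)
    (u : 'cV[quat R]_n) (z : quat R) (gamma : R) :
  u != 0 -> A *m u = \col_i (u i 0 * z) -> 0 <= gamma <= 1 ->
  qmod z <= max_rowcol gamma A.
Proof.
move=> u0 Au hg.
have [|i||i|//|i hi] := @subinvariant_le_row_col R n (fun i j => qmod (A i j))
  (fun i => qmod (u i 0)) (qmod z) gamma.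
- by move=> i j; apply: qmod_ge0.
- exact: qmod_ge0.
- have /cV0Pn[i ui] := u0; by exists i; rewrite qmod_gt0.
- rewrite mulrC -qmodM; have /matrixP/(_ i 0) := Au; rewrite !mxE => <-.
  by apply: le_trans (qmod_sum _ _ _) _; under eq_bigr do rewrite qmodM.
- by apply: le_trans hi _; apply: le_bigmax.
Qed.

(** The last row of the companion matrix is the only one in which the equation
    [p.[z] = 0] enters; each of the others shifts the column of powers. *)
Lemma companionmx_mul_powers (T : nzRingType) (p : {poly T}) (z : T) :
  p \is monic -> root p z ->
  companionmx p *m (\col_i z ^+ i) = \col_i (z ^+ i * z).
Proof.
move=> /monicP pm /rootP; rewrite horner_coef => pz.
apply/matrixP => i j; rewrite !mxE -exprSr.
have d0 : (0 < (size p).-1)%N by apply: leq_ltn_trans (ltn_ord i).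
have sp : size p = (size p).-1.+1 by rewrite prednK // (leq_trans d0) ?leq_pred.
under eq_bigr do rewrite !mxE.
case: (eqVneq (i : nat) (size p).-1.-1) => [->|ilast].
  move: pz; rewrite sp big_ord_recr /= -/(lead_coef p) pm mul1r prednK //.
  move=> /eqP; rewrite addrC addr_eq0 => /eqP ->.
  by rewrite -sumrN; apply: eq_bigr => k _; rewrite mulNr.
have i1 : (i.+1 < (size p).-1)%N.
  rewrite ltn_neqAle ltn_ord andbT; apply: contraNneq ilast => /(congr1 predn).
  by move=> /= ->.
rewrite (bigD1 (Ordinal i1)) //= eqxx mul1r big1 ?addr0 // => k ki.
by rewrite eq_sym (negbTE (ki : k != i.+1 :> nat)) mul0r.
Qed.

(* As a ring morphism, [qreal] makes [map_mx] commute with matrix products, so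
   that the real identity [W^-1 W = 1] transfers to quaternion matrices. *)
Lemma qreal_is_zmod_morphism (R : realType) : zmod_morphism (@qreal R).
Proof. by move=> a b; apply: quat_eq; rewrite /= ?subr0. Qed.

HB.instance Definition _ (R : realType) :=
  GRing.isZmodMorphism.Build R (quat R) (@qreal R) (@qreal_is_zmod_morphism R).

Lemma qreal_is_monoid_morphism (R : realType) : monoid_morphism (@qreal R).
Proof. by split=> [//|a b]; apply: quat_eq => /=; ring. Qed.

HB.instance Definition _ (R : realType) :=
  GRing.isMonoidMorphism.Build R (quat R) (@qreal R)
    (@qreal_is_monoid_morphism R).

Lemma weighted_mul (R : realType) (n : nat) (w : nat -> R)
    (A : 'M[quat R]_n) (v : 'cV[quat R]_n) :
  (forall i, (i < n)%N -> 0 < w i) ->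
  weighted w A *m (map_mx (@qreal R) (weightmx n w) *m v) =
  map_mx (@qreal R) (weightmx n w) *m (A *m v).
Proof.
move=> w0; have wU : weightmx n w \in unitmx.
  rewrite unitmxE det_diag unitfE; apply/prodf_neq0 => i _.
  by rewrite mxE gt_eqF // w0.
rewrite /weighted -!mulmxA; do 2 congr mulmx.
by rewrite mulmxA -map_mxM mulVmx // map_mx1 mul1mx.
Qed.

(** The upper bound, stated for any monic polynomial so that it also serves for
    the reversal. *)
Lemma root_le_max_rowcol (R : realType) (p : {poly quat R}) (w : nat -> R)
    (gamma : R) (z : quat R) :
  p \is monic -> (1 < size p)%N -> (forall i, (i < (size p).-1)%N -> 0 < w i) ->
  0 <= gamma <= 1 -> root p z ->
  qmod z <= max_rowcol gamma (weighted w (companionmx p)).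
Proof.
move=> pm sp w0 hg pz; set W := map_mx (@qreal R) (weightmx (size p).-1 w).
have WE (v : 'cV_(size p).-1) i : (W *m v) i 0 = qreal (w i) * v i 0.
  by rewrite /W map_diag_mx mul_diag_mx !mxE.
have d0 : (0 < (size p).-1)%N by rewrite -subn1 subn_gt0.
apply: (@right_eigen_le R _ _ (W *m \col_i z ^+ i)) => //.
  apply/cV0Pn; exists (Ordinal d0).
  rewrite WE mxE expr0 mulr1 -qmod_gt0.
  rewrite sqrtr_gt0 /qsqnorm /= !expr0n /= !addr0 exprn_gt0 //; exact: w0.
rewrite weighted_mul // companionmx_mul_powers //.
by apply/matrixP => i j; rewrite ord1 WE [RHS]mxE WE !mxE mulrA.
Qed.

(** * The reversal polynomial *)

Lemma reversal_monic (R : realType) (p : {poly quat R}) :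
  (1 < size p)%N -> reversal p \is monic.
Proof.
move=> sp; have m0 : (0 < (size p).-1)%N by rewrite -subn1 subn_gt0.
apply/monicP; rewrite /lead_coef size_reversal // /reversal !coefD coefXn eqxx.
rewrite coefC gtn_eqF // addr0 coef_sum big_nat big1 ?addr0 // => j /andP[j0 _].
by rewrite coefZ coefXn gtn_eqF ?mulr0 // ltn_subrL j0.
Qed.

(** The factor [(p`_0)^-1] comes out on the left and the powers of [z] on the
    right, so no commutation between coefficients and [z] is involved. *)
Lemma horner_reversal (R : realType) (p : {poly quat R}) (z : quat R) :
  p \is monic -> (1 < size p)%N -> p`_0 != 0 -> z != 0 ->
  (reversal p).[z^-1] = (p`_0)^-1 * p.[z] * z^-1 ^+ (size p).-1.
Proof.
move=> /monicP pm sp p0 z0.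
have m0 : (0 < (size p).-1)%N by rewrite -subn1 subn_gt0.
have sE : size p = (size p).-1.+1 by rewrite prednK // ltnW.
have zV k : z ^+ k * z^-1 ^+ k = 1.
  by rewrite -exprMn_comm ?divrr ?expr1n //; apply: commrV.
have -> : p.[z] = p`_0 + \sum_(1 <= j < (size p).-1) p`_j * z ^+ j
                  + z ^+ (size p).-1.
  rewrite horner_coef -(big_mkord xpredT (fun i => p`_i * z ^+ i)) sE /=.
  by rewrite big_nat_recr //= -/(lead_coef p) pm mul1r big_ltn // expr0 mulr1.
rewrite /reversal !hornerD hornerXn hornerC horner_sum !mulrDr !mulrDl.
rewrite mulVr // mul1r -[_ * z ^+ _ * _]mulrA zV mulr1.
congr (_ + _ + _); rewrite mulr_sumr mulr_suml.
apply: eq_big_nat => j /andP[_ jm].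
rewrite hornerZ hornerXn -!mulrA; congr (_ * (_ * _)).
by rewrite -{2}(subnKC (ltnW jm)) exprD mulrA zV mul1r.
Qed.

Theorem theorem4p6 (R : realType) (m : nat) (p : {poly quat R})
    (w : nat -> R) (gamma : R) (z : quat R) :
  (0 < m)%N -> size p = m.+1 -> p \is monic -> p`_0 != 0 ->
  (forall i, (i < m)%N -> 0 < w i) -> 0 <= gamma <= 1 ->
  root p z ->
  (max_rowcol gamma (weighted w (companionmx (reversal p))))^-1 <= qmod z
    <= max_rowcol gamma (weighted w (companionmx p)).
Proof.
move=> m0 sp pm p0 w0 hg pz.
have sp1 : (1 < size p)%N by rewrite sp ltnS.
have z0 : z != 0.
  by apply: contraNneq p0 => z0; move: pz; rewrite z0 rootE horner_coef0.
apply/andP; split; last by apply: root_le_max_rowcol => //; rewrite sp.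
have : qmod z^-1 <= max_rowcol gamma (weighted w (companionmx (reversal p))).
  apply: root_le_max_rowcol => //.
  - exact: reversal_monic.
  - by rewrite size_reversal.
  - by rewrite size_reversal // sp.
  - by rewrite rootE horner_reversal // (rootP pz) mulr0 mul0r.
have zV0 : 0 < qmod z^-1 by rewrite qmod_gt0 invr_eq0.
move=> h; rewrite -[z]invrK qmodV ?invr_eq0 // lef_pV2 ?posrE //.
exact: lt_le_trans h.
Qed.
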